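(* If $\phi\in\Lambda^p(\mathbf{R}^n)^*$ and $\psi\in\Lambda^q(\mathbf{R}^n)^*$, then $$\Vert\phi\wedge\psi\Vert^*\le C_{p+q,p}^2\,\Vert\phi\Vert^*\,\Vert\psi\Vert^* .$$
   Context: Let $\Lambda^p(\mathbf{R}^n)$ be the space of $p$-vectors in $\mathbf{R}^n$ with its standard Euclidean norm $|\cdot|$ (for an orthonormal basis $e_1,\dots,e_n$ of $\mathbf{R}^n$, the $p$-vectors $e_{i_1}\wedge\cdots\wedge e_{i_p}$, $i_1<\cdots<i_p$, are orthonormal), and let $\Lambda^p(\mathbf{R}^n)^*$ be its dual space, the space of $p$-covectors, with the dual Euclidean norm $|\cdot|^*$ and with the wedge product normalized so that the $e_{i_1}^*\wedge\cdots\wedge e_{i_p}^*$ are orthonormal and form the basis dual to the $e_{i_1}\wedge\cdots\wedge e_{i_p}$. A $p$-vector is simple if it is a wedge product of $p$ vectors. The comass of $\phi\in\Lambda^p(\mathbf{R}^n)^*$ is $$\Vert\phi\Vert^*=\sup\{\phi(\xi):\xi\in\Lambda^p(\mathbf{R}^n)\text{ simple},\ |\xi|\le 1\}.$$ Define $$C_{n,p}=\sup\left\{\frac{|\phi|^*}{\Vert\phi\Vert^*}:\phi\in\Lambda^p(\mathbf{R}^n)^*,\ \phi\ne0\right\}.$$ *)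

(* Defs.v *)
From HB Require Import structures.
From mathcomp Require Import all_boot all_order all_algebra.
From mathcomp Require Import all_classical all_reals.
From mathcomp Require Import lra.

Set Implicit Arguments.
Unset Strict Implicit.
Unset Printing Implicit Defensive.

Import Order.TTheory GRing.Theory Num.Theory.
Local Open Scope ring_scope.

(* The strictly increasing multi-indices i_1 < ... < i_p in {0, ..., n-1},
   encoded as the p-element subsets of 'I_n. *)
Definition multiindex (n p : nat) := {I : {set 'I_n} | #|I| == p}.

(* A p-vector is given by its coordinates on the basis
   e_I = e_{i_1} /\ ... /\ e_{i_p}, where e_1, ..., e_n is the standard basis. *)
Definition pvector (R : realType) (n p : nat) :=
  {ffun multiindex n p -> R^o}.

Definition pcovector (R : realType) (n p : nat) := 'Hom(pvector R n p, R^o).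

Section ExteriorAlgebra.
Variables (R : realType) (n : nat).

Definition basis_pvector p (I : multiindex n p) : pvector R n p :=
  [ffun K => (K == I)%:R].

Definition pnorm p (xi : pvector R n p) : R := Num.sqrt (\sum_I xi I ^+ 2).

(* The sign of the permutation sorting the concatenation of the increasing
   enumerations of I and J, i.e. e_I /\ e_J = shuffle_sign I J * e_(I U J) for
   disjoint I and J: the exponent counts the inversions. *)
Definition shuffle_sign (I J : {set 'I_n}) : R :=
  (-1) ^+ (\sum_(i in I) \sum_(j in J) (j < i)%N).

(* The bilinear operation with e_I /\ e_J as above if I and J are disjoint,
   and e_I /\ e_J = 0 otherwise. *)
Definition wedge p q (xi : pvector R n p) (eta : pvector R n q) :
    pvector R n (p + q) :=
  [ffun K => \sum_(I : multiindex n p) \sum_(J : multiindex n q |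
       [disjoint val I & val J] && (val I :|: val J == val K))
     shuffle_sign (val I) (val J) * (xi I * eta J)].

(* The identification of R^n with the 1-vectors: e_i corresponds to e_{i}. *)
Definition pvector_of_vector (v : 'rV[R]_n) : pvector R n 1 :=
  [ffun K : multiindex n 1 => (\sum_(i in val K) v 0 i : R^o)].

(* v_0 /\ (v_1 /\ ( ... /\ v_(p-1))); the empty product is the scalar 1 of
   the 0-vectors. *)
Fixpoint wedge_vectors p : ('I_p -> 'rV[R]_n) -> pvector R n p :=
  match p with
  | 0 => fun _ => [ffun => 1]
  | p'.+1 => fun v => wedge (pvector_of_vector (v ord0))
                            (wedge_vectors (fun i => v (lift ord0 i)))
  end.

(* The 0-vectors are the scalars, and all of them count as simple, so that the
   comass is the absolute value for p = 0 (with only the empty product 1 it would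
   not be a norm). *)
Definition simple_pvector p (xi : pvector R n p) : Prop :=
  p = 0%N \/ exists v : 'I_p -> 'rV[R]_n, xi = wedge_vectors v.

Lemma wedge_basis p q (I : multiindex n p) (J : multiindex n q)
    (K : multiindex n (p + q)) :
  [disjoint val I & val J] -> val I :|: val J = val K ->
  wedge (basis_pvector I) (basis_pvector J) =
    [ffun L => shuffle_sign (val I) (val J) * (L == K)%:R].
Proof.
move=> dis eqK; apply/ffunP => L; rewrite !ffunE (bigD1 I) //=.
rewrite [X in _ + X]big1 => [|I' nI].
  rewrite addr0 big_mkcond (bigD1 J) //= [X in _ + X]big1 => [|J' nJ].
    rewrite addr0 dis eqK /= !ffunE !eqxx mulr1 [val K == _]eq_sym.
    rewrite -[L == K](inj_eq val_inj) /=.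
    by case: (sval L == _); rewrite ?mulr1 ?mulr0 ?addr0.
  by case: ifP => // _; rewrite !ffunE (negbTE nJ) !mulr0.
by rewrite big1 // => J' _; rewrite !ffunE (negbTE nI) mul0r mulr0.
Qed.

Lemma wedge_vectors_basis p (s : 'I_p -> 'I_n) (I : multiindex n p) :
  (forall a b : 'I_p, (a < b)%N -> (s a < s b)%N) ->
  val I = [set s a | a : 'I_p]%SET ->
  wedge_vectors (fun a => delta_mx 0 (s a)) = basis_pvector I.
Proof.
elim: p s I => [|p IH] s I inc eI.
  apply/ffunP => K; rewrite !ffunE (_ : K == I = true) //.
  apply/eqP/val_inj; move: (valP K) (valP I).
  by rewrite !cards_eq0 => /eqP /= -> /eqP /= ->.
have sinj : injective s.
  move=> a b eab; apply/eqP; case: (ltngtP a b) => [/inc|/inc|/val_inj ->];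
    rewrite ?eab ?ltnn ?eqxx //.
rewrite /=.
have c1 : #|[set s ord0]%SET| == 1%N by rewrite cards1.
have c2 : #|[set s (lift ord0 a) | a : 'I_p]%SET| == p.
  by rewrite card_imset ?card_ord // => a b /sinj /lift_inj.
pose I1 : multiindex n 1 := Sub [set s ord0]%SET c1.
pose I2 : multiindex n p := Sub [set s (lift ord0 a) | a : 'I_p]%SET c2.
rewrite (IH (fun a => s (lift ord0 a)) I2) //; last first.
  by move=> a b ab; apply: inc; rewrite /= /bump /= !add1n.
have -> : pvector_of_vector (delta_mx 0 (s ord0)) = basis_pvector I1.
  apply/ffunP => K; rewrite !ffunE; have /cards1P[k eK] := valP K.
  rewrite -(inj_eq val_inj) /= eK big_set1 mxE eqxx /=; congr (nat_of_bool _)%:R.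
  by apply/eqP/eqP => [->|/set1_inj].
rewrite (@wedge_basis 1 p I1 I2 I) /=.
- apply/ffunP => L; rewrite !ffunE /shuffle_sign big_set1 big1 ?expr0 ?mul1r // => j.
  case/imsetP => a _ ->; have h := inc ord0 (lift ord0 a) isT.
  by rewrite ltnNge (ltnW h).
- rewrite disjoints1; apply/imsetP => -[a _ /sinj /eqP].
  by rewrite (negbTE (neq_lift _ _)).
- rewrite eI; apply/setP => x; rewrite inE finset.in_set1; apply/orP/imsetP.
    by case=> [/eqP ->|/imsetP[a _ ->]]; eexists.
  case=> a _ ->; case: (unliftP ord0 a) => [b|] ->; last by left.
  by right; apply/imsetP; exists b.
Qed.

(* The norm dual to the Euclidean norm; see dual_normE below. *)
Definition dual_norm p (phi : pcovector R n p) : R :=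
  sup [set phi xi | xi in [set xi : pvector R n p | pnorm xi <= 1]]%classic.

Definition comass p (phi : pcovector R n p) : R :=
  sup [set phi xi | xi in [set xi : pvector R n p |
                             simple_pvector xi /\ pnorm xi <= 1]]%classic.

Definition comass_const p : R :=
  sup [set dual_norm phi / comass phi |
         phi in [set phi : pcovector R n p | phi <> 0]]%classic.

(* covector_coords and covector_of_coords are inverse to each other: they relate
   a covector and its coordinates on the basis dual to the e_I. *)
Definition covector_coords p (phi : pcovector R n p) : pvector R n p :=
  [ffun I => phi (basis_pvector I)].

Definition covector_eval p (a xi : pvector R n p) : R^o := \sum_I a I * xi I.

Lemma covector_eval_is_linear p (a : pvector R n p) : linear (covector_eval a).
Proof.
move=> c xi eta; rewrite /covector_eval scaler_sumr -big_split /=.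
apply: eq_bigr => I _; rewrite !ffunE mulrDr; congr (_ + _).
exact: mulrCA.
Qed.

HB.instance Definition _ p (a : pvector R n p) :=
  GRing.isLinear.Build R (pvector R n p) R^o *:%R (covector_eval a)
    (covector_eval_is_linear a).

Definition covector_of_coords p (a : pvector R n p) : pcovector R n p :=
  linfun (covector_eval a).

(* The wedge product of covectors, for which the wedge products
   e_{i_1}^* /\ ... /\ e_{i_p}^* (i_1 < ... < i_p) are the basis dual to the e_I. *)
Definition cowedge p q (phi : pcovector R n p) (psi : pcovector R n q) :
    pcovector R n (p + q) :=
  covector_of_coords (wedge (covector_coords phi) (covector_coords psi)).

Lemma pvector_basisE p (xi : pvector R n p) :
  xi = \sum_I xi I *: basis_pvector I.
Proof.
apply/ffunP => K; rewrite sum_ffunE (bigD1 K) //= big1 => [|I neqI].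
  by rewrite addr0 !ffunE eqxx; exact/esym/mulr1.
by rewrite !ffunE eq_sym (negbTE neqI) scaler0.
Qed.

Lemma covectorE p (phi : pcovector R n p) (xi : pvector R n p) :
  phi xi = \sum_I phi (basis_pvector I) * xi I.
Proof.
rewrite {1}(pvector_basisE xi) linear_sum.
by apply: eq_bigr => I _; rewrite linearZ mulrC.
Qed.

Lemma covector_of_coordsE p (a xi : pvector R n p) :
  covector_of_coords a xi = \sum_I a I * xi I.
Proof. by rewrite lfunE. Qed.

Lemma covector_coordsK p : cancel (@covector_coords p) (@covector_of_coords p).
Proof.
move=> phi; apply/lfunP => xi; rewrite covector_of_coordsE covectorE.
by apply: eq_bigr => I _; rewrite ffunE.
Qed.

Lemma covector_of_coordsK p : cancel (@covector_of_coords p) (@covector_coords p).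
Proof.
move=> a; apply/ffunP => K; rewrite ffunE covector_of_coordsE (bigD1 K) //=.
rewrite big1 => [|I neqI]; first by rewrite addr0 ffunE eqxx mulr1.
by rewrite ffunE (negbTE neqI) mulr0.
Qed.

(* The basis dual to the e_I is orthonormal for the dual norm. *)
Lemma dual_normE p (phi : pcovector R n p) :
  dual_norm phi = Num.sqrt (\sum_I phi (basis_pvector I) ^+ 2).
Proof.
have ss_ge0 (f : multiindex n p -> R) : 0 <= \sum_I f I ^+ 2.
  by apply: sumr_ge0 => I _; exact: sqr_ge0.
set c := fun I => phi (basis_pvector I) : R.
have CS (xi : pvector R n p) : pnorm xi <= 1 ->
    phi xi <= Num.sqrt (\sum_I c I ^+ 2).
  move=> le1; set s := Num.sqrt _.
  have s2 : s ^+ 2 = \sum_I c I ^+ 2 by rewrite sqr_sqrtr.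
  have xi2 : \sum_I (xi I : R) ^+ 2 <= 1.
    by rewrite -(sqr_sqrtr (ss_ge0 _)) exprn_ile1 ?sqrtr_ge0.
  rewrite covectorE -/(c _); have [s0|s_neq0] := eqVneq s 0.
    rewrite s0 big1 // => I _.
    have /eqP : \sum_I c I ^+ 2 = 0 by rewrite -s2 s0 expr0n.
    rewrite psumr_eq0 => [|J _]; last exact: sqr_ge0.
    move=> /allP/(_ I (mem_index_enum I)) /=; rewrite sqrf_eq0 => /eqP.
    by rewrite /c => ->; rewrite mul0r.
  have s_gt0 : 0 < s by rewrite lt_neqAle eq_sym s_neq0 sqrtr_ge0.
  rewrite -(ler_pM2l s_gt0) -expr2.
  have : 0 <= \sum_I (c I - s * xi I) ^+ 2 by exact: ss_ge0.
  have -> : \sum_I (c I - s * xi I) ^+ 2 =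
      \sum_I c I ^+ 2 - (s * \sum_I c I * xi I) *+ 2
        + s ^+ 2 * \sum_I (xi I : R) ^+ 2.
    rewrite !mulr_sumr -sumrMnl -sumrN -!big_split /=.
    by apply: eq_bigr => I _; rewrite sqrrB exprMn mulrCA.
  rewrite -s2 => h.
  have : s ^+ 2 * \sum_I (xi I : R) ^+ 2 <= s ^+ 2 by rewrite ler_piMr ?sqr_ge0.
  rewrite /c in h *; lra.
apply/eqP; rewrite eq_le; apply/andP; split.
  apply: ge_sup; last by move=> _ [xi /CS le_s <-].
  exists (phi 0), 0 => //=; rewrite /pnorm big1 ?sqrtr0 // => I _.
  by rewrite ffunE expr0n.
set s := Num.sqrt _.
have s2 : s ^+ 2 = \sum_I c I ^+ 2 by rewrite sqr_sqrtr.
apply: ub_le_sup; first by exists s => _ [xi /CS le_s <-].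
exists [ffun I => s^-1 * c I].
  rewrite /= /pnorm; under eq_bigr do rewrite ffunE exprMn.
  rewrite -mulr_sumr -s2 -exprMn; have [->|s0] := eqVneq s 0.
    by rewrite mulr0 expr0n sqrtr0.
  by rewrite mulVf // expr1n sqrtr1.
rewrite covectorE.
under eq_bigr do rewrite ffunE mulrCA -expr2.
rewrite -mulr_sumr -s2; have [->|s0] := eqVneq s 0.
  by rewrite expr0n mulr0.
by rewrite expr2 mulKf.
Qed.

End ExteriorAlgebra.

(* Main.v *)
Require Import Defs.
From HB Require Import structures.
From mathcomp Require Import all_boot all_order all_algebra.
From mathcomp Require Import all_classical all_reals.
From mathcomp Require Import ring lra.
From mathcomp Require Import fintype finset.

Set Implicit Arguments.
Unset Strict Implicit.
Unset Printing Implicit Defensive.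

Import Order.TTheory GRing.Theory Num.Theory.
Local Open Scope ring_scope.

(** The comass of phi /\ psi is approached on simple (p + q)-vectors xi with
    norm at most 1.  Such a nonzero xi is c times the wedge product of p + q
    orthonormal vectors with |c| <= 1 (simple_decomposition), so xi is the image
    of the volume element of R^(p+q) under an isometric embedding Q, up to c.
    Pulling phi and psi back along Q does not increase their comass, because the
    map induced by an isometry preserves norms and simplicity
    (comass_pullback).  This reduces the inequality to n = p + q and to the
    single number (phi /\ psi)(e_1 /\ ... /\ e_(p+q)).

    That number is the Euclidean pairing of phi with the Hodge dual p-covector
    *psi, so the Cauchy-Schwarz inequality bounds it by |phi| |*psi|, hence by
    C^2 times the product of the comasses of phi and *psi, where
    C = C_(p+q,p).  Both factors are C_(p+q,p), and not C_(p+q,q) for the second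
    one, because the norms are compared after dualizing psi to degree p.

    It remains to see that the comass of *psi is at most that of psi
    (comass_hodge).  A simple p-vector of norm at most 1 is c times the image of
    e_1 /\ ... /\ e_p under some orthogonal T, obtained by completing an
    orthonormal family; since T preserves the volume element up to sign, *psi
    takes on it the value of psi on the image under T of
    e_(p+1) /\ ... /\ e_(p+q), up to a factor of absolute value at most 1.

    The algebra is done in the full exterior algebra of R^n, made into an
    associative ring so that wedge products of vectors are products of the ring
    and a matrix A induces a ring morphism emap A.  Two facts carry it: emap A is
    multiplicative (emapM) and its adjoint for the Euclidean inner product is
    emap A^T (inner_emap).  The second replaces the Cauchy-Binet formula and any
    computation with minors: it makes emap Q isometric when Q is. *)

(** * Signs of shuffles *)

Section Sign.
Variables (R : realType) (n : nat).
Implicit Types (I J K : {set 'I_n}) (i j : 'I_n).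
Local Notation sg := (@shuffle_sign R n).

Lemma shuffle_sign0l J : sg set0 J = 1.
Proof. by rewrite /shuffle_sign big_set0. Qed.

Lemma shuffle_sign0r I : sg I set0 = 1.
Proof. by rewrite /shuffle_sign big1 // => i _; rewrite big_set0. Qed.

Lemma shuffle_signUl I J K :
  [disjoint I & J] -> sg (I :|: J) K = sg I K * sg J K.
Proof.
move=> dIJ; rewrite /shuffle_sign -exprD -bigU //=; congr (_ ^+ _).
by apply: eq_bigl => i; rewrite !inE.
Qed.

Lemma shuffle_signUr I J K :
  [disjoint J & K] -> sg I (J :|: K) = sg I J * sg I K.
Proof.
move=> dJK; rewrite /shuffle_sign -exprD -big_split /=.
congr (_ ^+ _); apply: eq_bigr => i _; rewrite -bigU //=.
by apply: eq_bigl => j; rewrite !inE.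
Qed.

Lemma shuffle_sign1 i j : sg [set i] [set j] = (-1) ^+ (j < i)%N.
Proof. by rewrite /shuffle_sign !big_set1. Qed.

Lemma shuffle_sign_lt i J :
  (forall j, j \in J -> (i < j)%N) -> sg [set i] J = 1.
Proof.
move=> lt_iJ; rewrite /shuffle_sign big_set1 big1 // => j /lt_iJ lt_ij.
by rewrite ltnNge (ltnW lt_ij).
Qed.

Lemma shuffle_sign_sqr I J : sg I J ^+ 2 = 1.
Proof. by rewrite /shuffle_sign sqrr_sign. Qed.

End Sign.

(** * The exterior algebra as a ring *)

(** The coordinates on all e_I, of every degree at once.  Forgetting the degree
    avoids the transports between p + (q + r) and (p + q) + r that associativity
    of the graded product would need. *)
Definition exterior (R : realType) (n : nat) := {ffun {set 'I_n} -> R^o}.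

Section ExteriorRing.
Variables (R : realType) (n : nat).
Local Notation E := (exterior R n).
Local Notation sg := (@shuffle_sign R n).

HB.instance Definition _ := GRing.Lmodule.on E.

Lemma exteriorP (x y : E) : (forall K, x K = y K) -> x = y.
Proof. by move: x y; rewrite /exterior => x y h; apply/ffunP. Qed.

Definition ebasis (I : {set 'I_n}) : E := [ffun K : {set 'I_n} => (K == I)%:R].

Definition emul (x y : E) : E :=
  [ffun K : {set 'I_n} => \sum_(I : {set 'I_n} | I \subset K)
               sg I (K :\: I) * (x I * y (K :\: I))].

Fact emulA : associative emul.
Proof.
move=> x y z; apply: exteriorP => K; rewrite !ffunE.
under [RHS]eq_bigr do rewrite ffunE mulr_suml mulr_sumr.
rewrite [RHS](exchange_big_dep (fun I : {set 'I_n} => I \subset K)) /=; last first.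
  by move=> A I sAK sIA; exact: subset_trans sAK.
(* For fixed I, the set A between I and K is I together with a part B of K - I. *)
apply: eq_bigr => I sIK; rewrite ffunE !mulr_sumr.
rewrite [RHS](reindex_onto (fun B => I :|: B) (fun A => A :\: I)) /=; last first.
  by move=> A /andP[sAK sIA]; rewrite setDE setUIr setUCr setIT; apply/setUidPr.
apply: eq_big => [B|B /subsetDP].
  rewrite subsetD subUset sIK subsetUl andbT /= setDUl setDv set0U.
  by congr (_ && _); apply/setDidPl/eqP.
move=> [sBK dBI].
have -> : (I :|: B) :\: I = B.
  by rewrite setDUl setDv set0U; exact/setDidPl.
have -> : K :\: I :\: B = K :\: (I :|: B) by rewrite setDDl.
have -> : K :\: I = B :|: (K :\: (I :|: B)).
  apply/setP => a; rewrite !inE.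
  have [aB|_] := boolP (a \in B); last by case: (a \in I).
  by rewrite (disjointFr dBI aB) (subsetP sBK a aB).
rewrite shuffle_signUl 1?disjoint_sym // shuffle_signUr.
  ring.
rewrite -setI_eq0; apply/eqP/setP => a; rewrite !inE.
by case: (a \in B); rewrite ?orbT ?andbF.
Qed.

Fact emul1x : left_id (ebasis set0) emul.
Proof.
move=> x; apply: exteriorP => K; rewrite ffunE (bigD1 set0) ?sub0set //=.
rewrite big1 => [|I /andP[_ nI]]; last by rewrite ffunE (negbTE nI) mul0r mulr0.
by rewrite ffunE eqxx setD0 shuffle_sign0l !mul1r addr0.
Qed.

Fact emulx1 : right_id (ebasis set0) emul.
Proof.
move=> x; apply: exteriorP => K; rewrite ffunE (bigD1 K) ?subxx //=.
rewrite big1 => [|I /andP[sIK nI]]; last first.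
  rewrite ffunE setD_eq0 (_ : _ \subset _ = false) ?mulr0 //.
  by apply: contraNF nI => sKI; rewrite eqEsubset sIK.
by rewrite setDv ffunE eqxx shuffle_sign0r mul1r mulr1 addr0.
Qed.

Fact emulDl : left_distributive emul +%R.
Proof.
move=> x y z; apply: exteriorP => K; rewrite !ffunE -big_split /=.
by apply: eq_bigr => I _; rewrite ffunE; ring.
Qed.

Fact emulDr : right_distributive emul +%R.
Proof.
move=> x y z; apply: exteriorP => K; rewrite !ffunE -big_split /=.
by apply: eq_bigr => I _; rewrite ffunE; ring.
Qed.

Fact ebasis0_neq0 : ebasis set0 != 0.
Proof.
by apply/eqP => /(congr1 (fun x : E => x set0))/eqP; rewrite !ffunE eqxx oner_eq0.
Qed.

HB.instance Definition _ :=
  GRing.Zmodule_isNzRing.Build E emulA emul1x emulx1 emulDl emulDr ebasis0_neq0.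

Fact escalerAl (a : R) (x y : E) : a *: (x * y) = (a *: x) * y.
Proof.
apply: exteriorP => K; rewrite !ffunE scaler_sumr.
by apply: eq_bigr => I _; rewrite ffunE /GRing.scale /=; ring.
Qed.

HB.instance Definition _ := GRing.Lmodule_isLalgebra.Build R E escalerAl.

Fact escalerAr (a : R) (x y : E) : a *: (x * y) = x * (a *: y).
Proof.
apply: exteriorP => K; rewrite !ffunE scaler_sumr.
by apply: eq_bigr => I _; rewrite ffunE /GRing.scale /=; ring.
Qed.

HB.instance Definition _ := GRing.Lalgebra_isAlgebra.Build R E escalerAr.

End ExteriorRing.

(** * Basis elements, contractions and the inner product *)

(** Adding elements in decreasing order builds e_I by left multiplications that
    produce no sign, as in mul_ebasis_lt below. *)
Lemma set_min_ind n (P : {set 'I_n} -> Prop) :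
  P set0 ->
  (forall (i : 'I_n) (I : {set 'I_n}),
     (forall j, j \in I -> (i < j)%N) -> P I -> P (i |: I)) ->
  forall I, P I.
Proof.
move=> P0 PU I; have [k] := ubnP #|I|; elim: k I => // k IHk I.
have [->//|[i0 Ii0]] := set_0Vmem I.
have [i /= Ii min_i] := @arg_minnP _ i0 (fun i => i \in I) (@nat_of_ord n) Ii0.
rewrite (cardsD1 i) Ii ltnS => ltIk; rewrite -(setD1K Ii).
apply: PU => [j|]; last exact: IHk.
by rewrite !inE => /andP[ne_ji Ij]; rewrite ltn_neqAle eq_sym ne_ji min_i.
Qed.

Lemma enum_setU1_lt n (i : 'I_n) (I : {set 'I_n}) :
  (forall j, j \in I -> (i < j)%N) -> enum (i |: I) = i :: enum I.
Proof.
move=> lt_iI; have sorted_enum (J : {set 'I_n}) :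
    sorted (fun a b : 'I_n => (a < b)%N) (enum J).
  rewrite /enum_mem; apply: sorted_filter; first by move=> b a c; apply: ltn_trans.
  rewrite -enumT.
  rewrite -(@sorted_map _ _ (@nat_of_ord n) ltn).
  by rewrite val_enum_ord iota_ltn_sorted.
apply: (@irr_sorted_eq _ (fun a b : 'I_n => (a < b)%N)) => //.
- by move=> b a c; apply: ltn_trans.
- by move=> a; rewrite /= ltnn.
- rewrite /= path_min_sorted //; apply/allP => j.
  by rewrite mem_enum => /lt_iI.
- by move=> j; rewrite mem_enum !inE mem_enum.
Qed.

Section ExteriorTheory.
Variables (R : realType) (n : nat).
Local Notation E := (exterior R n).
Local Notation sg := (@shuffle_sign R n).
Local Notation ebasis := (@ebasis R n).
Implicit Types (I J K : {set 'I_n}) (i j : 'I_n) (x y z : E) (v w : 'rV[R]_n).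

Lemma ebasisE I K : ebasis I K = (K == I)%:R.
Proof. by rewrite ffunE. Qed.

Lemma emulE x y K :
  (x * y) K = \sum_(I : {set 'I_n} | I \subset K)
                sg I (K :\: I) * (x I * y (K :\: I)).
Proof. by rewrite ffunE. Qed.

Lemma exterior_addE x y K : (x + y) K = x K + y K.
Proof. by rewrite ffunE. Qed.

Lemma exterior_scaleE (a : R) x K : (a *: x) K = a * x K.
Proof. by rewrite ffunE. Qed.

Lemma exterior_sumE (T : Type) (r : seq T) (P : pred T) (F : T -> E) K :
  (\sum_(t <- r | P t) F t) K = \sum_(t <- r | P t) F t K.
Proof. by rewrite sum_ffunE. Qed.

Lemma exterior_ebasisE x : x = \sum_I x I *: ebasis I.
Proof.
apply: exteriorP => K; rewrite exterior_sumE (bigD1 K) //= big1 => [|I neqI].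
  by rewrite exterior_scaleE ebasisE eqxx mulr1 addr0.
by rewrite exterior_scaleE ebasisE eq_sym (negbTE neqI) mulr0.
Qed.

Lemma mul_ebasis I J : ebasis I * ebasis J =
  if [disjoint I & J] then sg I J *: ebasis (I :|: J) else 0.
Proof.
apply: exteriorP => K; rewrite emulE big_mkcond (bigD1 I) //= big1 => [|I' nI].
  rewrite !ebasisE eqxx mul1r addr0.
  have [dIJ|ndIJ] := boolP [disjoint I & J]; last first.
    rewrite ffunE; case: ifP => // sIK; case: eqP => [eJ|_]; last by rewrite mulr0.
    case/negP: ndIJ.
    by rewrite -eJ disjoint_sym disjoints_subset setDE subsetIr.
  rewrite exterior_scaleE ebasisE; have [->|nK] := eqVneq K (I :|: J).
    rewrite subsetUl setDUl setDv set0U.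
    have /setDidPl -> : [disjoint J & I] by rewrite disjoint_sym.
    by rewrite eqxx.
  rewrite mulr0; case: ifP => // sIK; case: eqP => [eJ|_]; last by rewrite mulr0.
  case/eqP: nK; rewrite -eJ; apply/setP => a; rewrite !inE.
  by have := subsetP sIK a; case: (a \in I) => //= ->.
by case: ifP => // _; rewrite ebasisE (negbTE nI) mul0r mulr0.
Qed.

Lemma ebasis0 : ebasis set0 = 1.
Proof. by []. Qed.

Lemma mul_ebasis_lt i I :
  (forall j, j \in I -> (i < j)%N) -> ebasis [set i] * ebasis I = ebasis (i |: I).
Proof.
move=> lt_iI; rewrite mul_ebasis disjoints1 shuffle_sign_lt // scale1r ifT //.
by apply/negP => /lt_iI; rewrite ltnn.
Qed.

Lemma mul_ebasis1C i j : ebasis [set i] * ebasis [set j] = - (ebasis [set j] * ebasis [set i]).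
Proof.
rewrite !mul_ebasis !disjoints1 !inE eq_sym; have [//|nij /=] := eqVneq j i.
  by rewrite oppr0.
rewrite setUC !shuffle_sign1 -scaleNr; congr (_ *: _).
case: (ltngtP i j) => [||/val_inj eij]; rewrite ?expr0 ?expr1 ?opprK //.
by rewrite eij eqxx in nij.
Qed.

Definition vec v : E := \sum_i v 0 i *: ebasis [set i].

Fact vec_is_linear : linear vec.
Proof.
move=> a v w; rewrite /vec scaler_sumr -big_split; apply: eq_bigr => i _ /=.
by rewrite !mxE scalerDl scalerA.
Qed.

HB.instance Definition _ :=
  GRing.isLinear.Build R 'rV[R]_n E *:%R vec vec_is_linear.

Lemma vec_delta i : vec (delta_mx 0 i) = ebasis [set i].
Proof.
rewrite /vec (bigD1 i) //= big1 => [|j nji]; last first.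
  by rewrite mxE eqxx (negbTE nji) scale0r.
by rewrite mxE !eqxx scale1r addr0.
Qed.

Lemma vec_mulC v w : vec v * vec w = - (vec w * vec v).
Proof.
rewrite /vec !mulr_suml; under eq_bigr do rewrite mulr_sumr.
under [in RHS]eq_bigr do rewrite mulr_sumr.
rewrite exchange_big /= -sumrN; apply: eq_bigr => i _; rewrite -sumrN.
apply: eq_bigr => j _.
by rewrite -!scalerAl -!scalerAr mul_ebasis1C !scalerN !scalerA mulrC.
Qed.

(** Anticommutation gives only 2 v^2 = 0; the characteristic is 0. *)
Lemma vec_sqr v : vec v * vec v = 0.
Proof.
have /eqP := vec_mulC v v; rewrite -addr_eq0 -mulr2n -scaler_nat.
by rewrite scaler_eq0 pnatr_eq0 => /eqP.
Qed.

Lemma ebasis_prod I : ebasis I = \prod_(i <- enum I) ebasis [set i].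
Proof.
elim/set_min_ind: I => [|i I lt_iI IHI]; first by rewrite enum_set0 big_nil.
by rewrite enum_setU1_lt // big_cons -IHI mul_ebasis_lt.
Qed.

Definition inner x y : R := \sum_K x K * y K.

Lemma innerC x y : inner x y = inner y x.
Proof. by apply: eq_bigr => K _; rewrite mulrC. Qed.

Lemma inner_is_linear x : scalar (inner x).
Proof.
move=> a y z; rewrite /inner mulr_sumr -big_split; apply: eq_bigr => K _ /=.
by rewrite exterior_addE exterior_scaleE; ring.
Qed.

HB.instance Definition _ x :=
  GRing.isLinear.Build R E R^o *:%R (inner x) (inner_is_linear x).

Lemma innerZr a x y : inner x (a *: y) = a * inner x y.
Proof. exact: linearZ. Qed.

Lemma innerZl a x y : inner (a *: x) y = a * inner x y.
Proof. by rewrite !(innerC _ y) innerZr. Qed.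

Lemma inner_ebasisr x I : inner x (ebasis I) = x I.
Proof.
rewrite /inner (bigD1 I) //= big1 => [|K nKI]; first by rewrite ebasisE eqxx mulr1 addr0.
by rewrite ebasisE (negbTE nKI) mulr0.
Qed.

Lemma emul_ebasis1E i x K :
  (ebasis [set i] * x) K = if i \in K then sg [set i] (K :\ i) * x (K :\ i) else 0.
Proof.
rewrite emulE big_mkcond (bigD1 [set i]) //= big1 => [|I nI].
  by rewrite ebasisE eqxx mul1r addr0 sub1set.
by case: ifP => // _; rewrite ebasisE (negbTE nI) mul0r mulr0.
Qed.

(** The contraction by e_i, that is, the adjoint of left multiplication by e_i
    (inner_ebasis1_mul). *)
Definition intprod i x : E :=
  [ffun K : {set 'I_n} => if i \in K then 0 else sg [set i] K * x (i |: K)].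

Fact intprod_is_linear i : linear (intprod i).
Proof.
move=> a x y; apply: exteriorP => K.
rewrite exterior_addE exterior_scaleE !ffunE; case: ifP => _.
  by rewrite mulr0 addr0.
by rewrite /GRing.scale /=; ring.
Qed.

HB.instance Definition _ i :=
  GRing.isLinear.Build R E E *:%R (intprod i) (intprod_is_linear i).

Lemma inner_ebasis1_mul i x y : inner (ebasis [set i] * x) y = inner x (intprod i y).
Proof.
rewrite /inner.
under eq_bigr do rewrite emul_ebasis1E.
under [RHS]eq_bigr do rewrite ffunE.
rewrite (bigID (fun K : {set 'I_n} => i \in K)) /= [X in _ + X]big1 ?addr0; last first.
  by move=> K /negbTE ->; rewrite mul0r.
rewrite [RHS](bigID (fun K : {set 'I_n} => i \in K)) /= [X in _ = X + _]big1 ?add0r; last first.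
  by move=> K ->; rewrite mulr0.
rewrite [RHS](reindex_onto (fun K => K :\ i) (fun K => i |: K)) /=; last first.
  by move=> K niK; rewrite setU1K.
apply: eq_big => [K|K iK].
  rewrite !inE eqxx /=; apply/idP/eqP => [/setD1K //|<-]; exact: setU11.
by rewrite iK !inE eqxx /= setD1K //; ring.
Qed.

Lemma intprod1 i : intprod i 1 = 0.
Proof.
apply: exteriorP => K; rewrite -ebasis0 !ffunE; case: ifP => // _.
case: eqP => [e|]; last by rewrite mulr0.
by have := setU11 i K; rewrite e inE.
Qed.

(** The anticommutation relation of creation and annihilation operators: a
    contraction is an antiderivation.  For i and j distinct, the two terms differ
    by the one inversion that i and j form, whence the opposite signs. *)
Lemma intprod_ebasis1_mul i j x :
  intprod i (ebasis [set j] * x) = (i == j)%:R *: x - ebasis [set j] * intprod i x.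
Proof.
apply: exteriorP => K; rewrite exterior_addE exterior_scaleE.
have -> : (- (ebasis [set j] * intprod i x)) K = - (ebasis [set j] * intprod i x) K.
  by rewrite ffunE.
rewrite emul_ebasis1E [LHS]ffunE emul_ebasis1E [intprod i x _]ffunE !inE.
have [<-|nij] := eqVneq i j.
  rewrite /= mul1r; have [iK|niK] := boolP (i \in K).
    rewrite (setD1K iK) mulrA -expr2 shuffle_sign_sqr; ring.
  rewrite setU1K // mulrA -expr2 shuffle_sign_sqr; ring.
rewrite mul0r add0r /=.
have [iK|niK] := boolP (i \in K).
  by case: ifP => _; rewrite ?mulr0 oppr0.
case: ifP => [jK|_]; last by rewrite mulr0 oppr0.
have -> : (i |: K) :\ j = i |: (K :\ j).
  apply/setP => a; rewrite !inE; have [->|//] := eqVneq a i.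
  by rewrite nij.
rewrite shuffle_signUr ?disjoints1 ?inE ?(negbTE niK) ?andbF //.
rewrite -{1}(setD1K jK) (shuffle_signUr R) ?disjoints1 ?inE ?eqxx //.
rewrite !shuffle_sign1; case: (ltngtP i j) => [||/val_inj eij].
- by move=> _; rewrite expr0 expr1; ring.
- by move=> _; rewrite expr0 expr1; ring.
- by rewrite eij eqxx in nij.
Qed.

End ExteriorTheory.

(** * Ring morphisms induced by matrices *)

(** A linear property that holds at 1 and is stable under left multiplication by
    the e_i holds everywhere, as the e_i generate the algebra.  Identities between
    morphisms, contractions and adjoints reduce to the generators this way. *)
Lemma exterior_ind (R : realType) n (P : exterior R n -> Prop) :
  (forall a x y, P x -> P y -> P (a *: x + y)) ->
  P 1 -> (forall i x, P x -> P (ebasis R [set i] * x)) ->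
  forall x, P x.
Proof.
move=> Plin P1 Pmul x.
have P0 : P 0 by rewrite -[0](subrr 1) addrC -scaleN1r; exact: Plin.
have Peb I : P (ebasis R I).
  elim/set_min_ind: I => // i I lt_iI PI.
  by rewrite -mul_ebasis_lt //; exact: Pmul.
rewrite (exterior_ebasisE x); elim/big_rec: _ => // I y _ Py; exact: Plin.
Qed.

Section ExteriorMap.
Variables (R : realType) (m n : nat) (A : 'M[R]_(m, n)).
Implicit Types (I J K : {set 'I_m}) (i j : 'I_m) (x y : exterior R m).
Local Notation w i := (vec (row i A)).

(** The map induced on the exterior algebras by v |-> v A.  On e_I it is the
    product of the rows of A with index in I, in increasing order. *)
Definition emap x : exterior R n := \sum_I x I *: \prod_(i <- enum I) w i.

Fact emap_is_linear : linear emap.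
Proof.
move=> a x y; rewrite /emap scaler_sumr -big_split /=; apply: eq_bigr => I _.
by rewrite exterior_addE exterior_scaleE scalerDl scalerA.
Qed.

HB.instance Definition _ :=
  GRing.isLinear.Build R (exterior R m) (exterior R n) *:%R emap emap_is_linear.

Lemma emap_ebasis I : emap (ebasis R I) = \prod_(i <- enum I) w i.
Proof.
rewrite /emap (bigD1 I) //= [X in _ + X]big1 => [|J nJ].
  by rewrite ebasisE eqxx scale1r addr0.
by rewrite ebasisE (negbTE nJ) scale0r.
Qed.

Lemma emap1 : emap 1 = 1.
Proof. by rewrite -ebasis0 emap_ebasis enum_set0 big_nil. Qed.

Lemma emap_ebasis1 i : emap (ebasis R [set i]) = w i.
Proof. by rewrite emap_ebasis enum_set1 big_seq1. Qed.

Lemma emap_ebasis_lt i I : (forall j, j \in I -> (i < j)%N) ->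
  emap (ebasis R (i |: I)) = w i * emap (ebasis R I).
Proof. by move=> lt_iI; rewrite !emap_ebasis enum_setU1_lt // big_cons. Qed.

(** Moving the row of index i to its place among the rows indexed by J uses only
    that rows anticommute and square to zero, relations that the e_i satisfy as
    well; so both sides are rearranged by the same steps, and the signs need not
    be computed. *)
Lemma emap_ebasis1_mul i x : emap (ebasis R [set i] * x) = w i * emap x.
Proof.
rewrite (exterior_ebasisE x) mulr_sumr !linear_sum mulr_sumr; apply: eq_bigr => J _.
rewrite -scalerAr !linearZ /= -scalerAr; congr (_ *: _).
elim/set_min_ind: J i => [|j J lt_jJ IHJ] i.
  by rewrite ebasis0 mulr1 emap1 mulr1 emap_ebasis1.
have [lt_ij|lt_ji|/val_inj ->] := ltngtP i j.
- have lt_i k : k \in j |: J -> (i < k)%N.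
    by rewrite !inE => /predU1P[->//|/lt_jJ]; apply: ltn_trans.
  by rewrite mul_ebasis_lt // emap_ebasis_lt.
- rewrite emap_ebasis_lt // -mul_ebasis_lt // !mulrA mul_ebasis1C vec_mulC !mulNr linearN.
  congr (- _); rewrite -!mulrA -IHJ mul_ebasis; case: ifP => _; last first.
    by rewrite mulr0 !linear0 mulr0.
  rewrite -scalerAr !linearZ /= -scalerAr; congr (_ *: _).
  have lt_j k : k \in i |: J -> (j < k)%N.
    by rewrite !inE => /predU1P[->//|/lt_jJ].
  by rewrite mul_ebasis_lt // emap_ebasis_lt.
- rewrite emap_ebasis_lt // -mul_ebasis_lt // !mulrA -vec_delta !vec_sqr.
  by rewrite !mul0r linear0.
Qed.

Lemma emapM x y : emap (x * y) = emap x * emap y.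
Proof.
elim/exterior_ind: x => [a x z IHx IHz||i x IHx].
- by rewrite mulrDl -scalerAl !linearP /= IHx IHz mulrDl scalerAl.
- by rewrite emap1 !mul1r.
- by rewrite -mulrA !emap_ebasis1_mul IHx mulrA.
Qed.

HB.instance Definition _ :=
  GRing.isMonoidMorphism.Build (exterior R m) (exterior R n) emap (conj emap1 emapM).

Lemma emap_vec (v : 'rV[R]_m) : emap (vec v) = vec (v *m A).
Proof.
rewrite {1}/vec linear_sum mulmx_sum_row linear_sum; apply: eq_bigr => i _.
by rewrite !linearZ /= emap_ebasis1.
Qed.

Lemma intprod_vec_mul (k : 'I_n) (v : 'rV[R]_n) (z : exterior R n) :
  intprod k (vec v * z) = v 0 k *: z - vec v * intprod k z.
Proof.
rewrite /vec !mulr_suml linear_sum (bigD1 k) //= [in RHS](bigD1 k) //=.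
rewrite -!scalerAl !linearZ /= intprod_ebasis1_mul eqxx scale1r scalerBr opprD addrA.
congr (_ + _); rewrite -sumrN; apply: eq_bigr => i nik.
rewrite -!scalerAl linearZ /= intprod_ebasis1_mul eq_sym (negbTE nik) scale0r add0r.
by rewrite scalerN.
Qed.

(** Contractions are carried through emap A by the transpose of A: both sides obey
    the antiderivation rule, and they agree on vectors. *)
Lemma intprod_emap (k : 'I_n) x :
  intprod k (emap x) = emap (\sum_i A i k *: intprod i x).
Proof.
elim/exterior_ind: x => [a x y IHx IHy||j x IHx].
- rewrite !linearP /= IHx IHy -linearP; congr emap.
  rewrite scaler_sumr -big_split; apply: eq_bigr => i _ /=.
  by rewrite linearP scalerDr !scalerA mulrC.
- rewrite emap1 intprod1 big1 ?linear0 // => i _.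
  by rewrite intprod1 scaler0.
- rewrite emap_ebasis1_mul intprod_vec_mul IHx mxE.
  under [in RHS]eq_bigr do rewrite intprod_ebasis1_mul scalerBr scalerA.
  rewrite big_split /= linearD; congr (_ + _).
    rewrite (bigD1 j) //= eqxx mulr1 big1 ?addr0 ?linearZ // => i nij.
    by rewrite (negbTE nij) mulr0 scale0r.
  rewrite -emap_ebasis1_mul sumrN linearN mulr_sumr; congr (- emap _).
  by apply: eq_bigr => i _; rewrite scalerAr.
Qed.

Lemma emap_set0 x : emap x set0 = x set0.
Proof.
elim/exterior_ind: x => [a x y IHx IHy||i x IHx].
- by rewrite linearP /= !exterior_addE !exterior_scaleE IHx IHy.
- by rewrite emap1 -ebasis0 !ebasisE !eqxx.
- rewrite emap_ebasis1_mul /vec mulr_suml exterior_sumE big1 => [|k _].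
    by rewrite emul_ebasis1E inE.
  by rewrite -scalerAl exterior_scaleE emul_ebasis1E inE mulr0.
Qed.

End ExteriorMap.

Section Adjoint.
Variable (R : realType).

Lemma emap_comp m n p (A : 'M[R]_(m, n)) (B : 'M_(n, p)) x :
  emap B (emap A x) = emap (A *m B) x.
Proof.
elim/exterior_ind: x => [a x y IHx IHy||i x IHx].
- by rewrite !linearP /= IHx IHy.
- by rewrite !rmorph1.
- by rewrite !rmorphM /= IHx !emap_ebasis1 emap_vec row_mul.
Qed.

Lemma emap_id n (x : exterior R n) : emap 1%:M x = x.
Proof.
elim/exterior_ind: x => [a x y IHx IHy||i x IHx].
- by rewrite !linearP /= IHx IHy.
- by rewrite !rmorph1.
- by rewrite !rmorphM /= IHx emap_ebasis1 row1 vec_delta.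
Qed.

(** Induction on x: a factor e_i on the left of x becomes a contraction of the
    other argument, which commutes with emap as in intprod_emap.  On coordinates
    this says that a minor equals the minor of the transposed matrix. *)
Lemma inner_emap m n (A : 'M[R]_(m, n)) x y :
  inner (emap A x) y = inner x (emap A^T y).
Proof.
elim/exterior_ind: x y => [a x z IHx IHz y|y|i x IHx y].
- by rewrite linearP /= !(innerC (_ + _)) !linearP /= !(innerC y) IHx IHz !(innerC _ (emap A^T y)).
- by rewrite rmorph1 !(innerC 1) -!ebasis0 !inner_ebasisr emap_set0.
- rewrite inner_ebasis1_mul intprod_emap emap_ebasis1_mul /vec mulr_suml innerC linear_sum.
  rewrite [emap A^T _]linear_sum linear_sum /=; apply: eq_bigr => k _.
  by rewrite -scalerAl innerZr innerC inner_ebasis1_mul IHx linearZ innerZr !mxE.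
Qed.

Lemma inner_emap_isometry m n (Q : 'M[R]_(m, n)) x y :
  Q *m Q^T = 1%:M -> inner (emap Q x) (emap Q y) = inner x y.
Proof. by move=> QQt; rewrite inner_emap emap_comp QQt emap_id. Qed.

End Adjoint.

(** * The p-vectors inside the exterior algebra *)

Section Embedding.
Variables (R : realType) (n : nat).
Local Notation E := (exterior R n).
Implicit Types (K : {set 'I_n}).

Definition embed p (x : pvector R n p) : E := \sum_I x I *: ebasis R (val I).

Fact embed_is_linear p : linear (@embed p).
Proof.
move=> a x y; rewrite /embed scaler_sumr -big_split /=; apply: eq_bigr => I _.
by rewrite !ffunE scalerDl scalerA.
Qed.

HB.instance Definition _ p :=
  GRing.isLinear.Build R (pvector R n p) E *:%R (@embed p) (@embed_is_linear p).

Lemma embed_val p (x : pvector R n p) (I : multiindex n p) : embed x (val I) = x I.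
Proof.
rewrite /embed exterior_sumE (bigD1 I) //= big1 => [|J nJ].
  by rewrite exterior_scaleE ebasisE eqxx mulr1 addr0.
by rewrite exterior_scaleE ebasisE (inj_eq val_inj) eq_sym (negbTE nJ) mulr0.
Qed.

Lemma embed_card p (x : pvector R n p) K : #|K| != p -> embed x K = 0.
Proof.
move=> nK; rewrite /embed exterior_sumE big1 // => I _.
rewrite exterior_scaleE ebasisE; case: eqP => [eK|_]; last by rewrite mulr0.
by rewrite eK (eqP (valP I)) eqxx in nK.
Qed.

Lemma embed_inj p : injective (@embed p).
Proof.
move=> x y exy; have exyE I : x I = y I by rewrite -!embed_val exy.
exact/ffunP.
Qed.

Lemma embed_proj p (z : E) : (forall K, #|K| != p -> z K = 0) ->
  embed [ffun I : multiindex n p => z (val I)] = z.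
Proof.
move=> z0; apply: exteriorP => K; have [cK|nK] := eqVneq #|K| p.
  have cK' : #|K| == p by apply/eqP.
  by rewrite -[K]/(val (Sub K cK' : multiindex n p)) embed_val ffunE.
by rewrite embed_card ?z0.
Qed.

Lemma inner_ext p (x y : pvector R n p) :
  inner (embed x) (embed y) = \sum_I x I * y I.
Proof.
rewrite {2}/embed linear_sum; apply: eq_bigr => I _.
by rewrite linearZ /= inner_ebasisr embed_val; exact: mulrC.
Qed.

Lemma pnorm_sqr p (x : pvector R n p) : pnorm x ^+ 2 = inner (embed x) (embed x).
Proof.
rewrite sqr_sqrtr; first by rewrite inner_ext; apply: eq_bigr => I _; rewrite expr2.
by apply: sumr_ge0 => I _; exact: sqr_ge0.
Qed.

Lemma embed_basis p (I : multiindex n p) : embed (basis_pvector R I) = ebasis R (val I).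
Proof.
rewrite /embed (bigD1 I) //= big1 => [|J nJ]; first by rewrite ffunE eqxx scale1r addr0.
by rewrite ffunE (negbTE nJ) scale0r.
Qed.

Lemma embed_wedge p q (x : pvector R n p) (y : pvector R n q) :
  embed (wedge x y) = embed x * embed y.
Proof.
have -> : embed x * embed y =
    \sum_I \sum_J (x I * y J) *: (ebasis R (val I) * ebasis R (val J)).
  rewrite /embed mulr_suml; apply: eq_bigr => I _; rewrite mulr_sumr.
  apply: eq_bigr => J _.
  by rewrite -scalerAl -scalerAr scalerA.
rewrite {1}/embed; under eq_bigr do rewrite ffunE scaler_suml.
rewrite exchange_big /=; apply: eq_bigr => I _.
under eq_bigr do rewrite big_mkcond scaler_suml.
rewrite exchange_big /=; apply: eq_bigr => J _.
rewrite mul_ebasis; case: ifP => [dIJ|_]; last first.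
  by rewrite scaler0 big1 // => K _; rewrite scale0r.
have cIJ : #|val I :|: val J| == (p + q)%N.
  rewrite cardsU (eqP (valP I)) (eqP (valP J)).
  by move: dIJ; rewrite -setI_eq0 => /eqP ->; rewrite cards0 subn0.
rewrite (bigD1 (Sub (val I :|: val J) cIJ : multiindex n (p + q))) //= big1 => [|K nK].
  by rewrite eqxx addr0 !scalerA mulrC.
rewrite [_ == _](_ : _ = false) ?scale0r //.
by apply: contraNF nK => /eqP eK; apply/eqP/val_inj; rewrite /= eK.
Qed.

Lemma embed_vector (v : 'rV[R]_n) : embed (pvector_of_vector v) = vec v.
Proof.
rewrite /vec -(embed_proj (p := 1) (z := \sum_i _)) => [|K nK].
  congr embed; apply/ffunP => K; rewrite !ffunE exterior_sumE.
  rewrite [RHS](bigID (mem (val K))) /= [X in _ = _ + X]big1 ?addr0 => [|i nKi].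
    apply: eq_bigr => i Ki; rewrite exterior_scaleE ebasisE.
    have /cards1P[j ej] := valP K.
    by move: Ki; rewrite ej inE => /eqP ->; rewrite eqxx mulr1.
  rewrite exterior_scaleE ebasisE; case: eqP => [ej|_]; last by rewrite mulr0.
  by rewrite ej set11 in nKi.
rewrite exterior_sumE big1 // => i _; rewrite exterior_scaleE ebasisE.
case: eqP => [eK|_]; last by rewrite mulr0.
by rewrite eK cards1 in nK.
Qed.

Lemma embed_wedge_vectors p (v : 'I_p -> 'rV[R]_n) :
  embed (wedge_vectors v) = \prod_(i < p) vec (v i).
Proof.
elim: p v => [|p IHp] v; last by rewrite /= (@embed_wedge 1 p) embed_vector IHp big_ord_recl.
rewrite big_ord0 -ebasis0.
rewrite -(embed_proj (p := 0) (z := ebasis R set0)) => [|K].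
  congr embed; apply/ffunP => I; rewrite !ffunE.
  by have := valP I; rewrite cards_eq0 => ->.
by rewrite cards_eq0 ebasisE => /negbTE ->.
Qed.

Lemma covector_inner p (phi : pcovector R n p) xi :
  phi xi = inner (embed (covector_coords phi)) (embed xi).
Proof. by rewrite covectorE inner_ext; apply: eq_bigr => I _; rewrite ffunE. Qed.

Lemma simple0 p : simple_pvector (0 : pvector R n p).
Proof.
case: p => [|p]; [by left|right]; exists (fun=> 0).
by apply: embed_inj; rewrite embed_wedge_vectors big_ord_recl !linear0 mul0r.
Qed.

Lemma simpleZ p c (xi : pvector R n p) :
  simple_pvector xi -> simple_pvector (c *: xi).
Proof.
case: p xi => [|p] xi; first by left.
case=> // -[v ->]; right.
exists (fun i => if i == ord0 then c *: v i else v i).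
apply: embed_inj; rewrite linearZ !embed_wedge_vectors !big_ord_recl /=.
rewrite linearZ /= -scalerAl.
by rewrite (@embed_wedge 1 p) embed_vector embed_wedge_vectors.
Qed.

(** For p = 0 the basis vector is the empty product, so the second alternative of
    simplicity applies in every degree. *)
Lemma simple_basis p (I : multiindex n p) : simple_pvector (basis_pvector R I).
Proof.
right; have sI : size (enum (val I)) == p by rewrite -cardE (valP I).
exists (fun i => delta_mx 0 (tnth (Tuple sI) i)).
apply: embed_inj; rewrite embed_basis embed_wedge_vectors ebasis_prod.
rewrite -[enum _]/(val (Tuple sI)) big_tuple.
by apply: eq_bigr => i _; rewrite vec_delta.
Qed.

End Embedding.

Section EmbeddingMap.
Variable (R : realType).

Lemma emap_card m n (A : 'M[R]_(m, n)) (I : {set 'I_m}) (K : {set 'I_n}) :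
  #|K| != #|I| -> emap A (ebasis R I) K = 0.
Proof.
elim/set_min_ind: I K => [|i I lt_iI IHI] K nK.
  rewrite ebasis0 emap1 -ebasis0 ebasisE; case: eqVneq => // eK.
  by rewrite eK !cards0 in nK.
rewrite emap_ebasis_lt // /vec mulr_suml exterior_sumE big1 // => k _.
rewrite -scalerAl exterior_scaleE emul_ebasis1E; case: ifP => Kk; last by rewrite mulr0.
rewrite IHI ?mulr0 //; apply: contraNneq nK => eK.
rewrite (cardsD1 k) Kk eK cardsU1 (_ : i \notin I) //.
by apply/negP => /lt_iI; rewrite ltnn.
Qed.

Definition pv_map m n p (A : 'M[R]_(m, n)) (x : pvector R m p) : pvector R n p :=
  [ffun I : multiindex n p => emap A (embed x) (val I)].

Lemma embed_pv_map m n p (A : 'M[R]_(m, n)) (x : pvector R m p) :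
  embed (pv_map A x) = emap A (embed x).
Proof.
apply: embed_proj => K nK; rewrite [embed x in LHS]/embed linear_sum exterior_sumE big1 // => I _.
by rewrite linearZ exterior_scaleE /= emap_card ?mulr0 // (eqP (valP I)).
Qed.

Lemma pv_map_wedge_vectors m n p (A : 'M[R]_(m, n)) (v : 'I_p -> 'rV_m) :
  pv_map A (wedge_vectors v) = wedge_vectors (fun i => v i *m A).
Proof.
apply: embed_inj; rewrite embed_pv_map !embed_wedge_vectors rmorph_prod.
by apply: eq_bigr => i _; rewrite /= emap_vec.
Qed.

Lemma simple_pv_map m n p (A : 'M[R]_(m, n)) (x : pvector R m p) :
  simple_pvector x -> simple_pvector (pv_map A x).
Proof.
case=> [p0|[v ->]]; first by left.
by right; rewrite pv_map_wedge_vectors; eexists.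
Qed.

Lemma pnorm_pv_map m n p (Q : 'M[R]_(m, n)) (x : pvector R m p) :
  Q *m Q^T = 1%:M -> pnorm (pv_map Q x) = pnorm x.
Proof.
move=> QQt; apply/eqP; rewrite -(@eqrXn2 _ 2) ?sqrtr_ge0 //.
by rewrite !pnorm_sqr embed_pv_map inner_emap_isometry.
Qed.

Lemma embed_top n (x : pvector R n n) :
  embed x = embed x [set: 'I_n]%SET *: ebasis R [set: 'I_n]%SET.
Proof.
apply: exteriorP => K; rewrite exterior_scaleE ebasisE.
have [->|nK] := eqVneq K [set: 'I_n]%SET; first by rewrite mulr1.
rewrite mulr0 embed_card //; apply: contraNneq nK => cK.
by rewrite eqEcard subsetT cardsT card_ord cK leqnn.
Qed.

(** * Orthonormal bases and simple p-vectors *)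

(** Gram-Schmidt on row spaces: split off a unit row e of A and apply the induction
    hypothesis to A projected onto the orthogonal complement of e, whose rank is
    one less.  The rank is a variable r so that it can be any number known to be
    equal to it, with no cast of Q. *)
Lemma orthonormal_basis r m n (A : 'M[R]_(m, n)) : \rank A = r ->
  exists Q : 'M[R]_(r, n), [/\ Q *m Q^T = 1%:M, (A <= Q)%MS & (Q <= A)%MS].
Proof.
elim: r m A => [|r IHr] m A rA.
  exists 0; move/eqP: rA; rewrite mxrank_eq0 => /eqP ->.
  by split; rewrite ?sub0mx // [LHS]flatmx0 [RHS]flatmx0.
have nzA : nz_row A != 0 by rewrite nz_row_eq0 -mxrank_eq0 rA.
set u := nz_row A in nzA; set s : R := (u *m u^T) 0 0.
have s_gt0 : 0 < s.
  have s_sum : s = \sum_j u 0 j ^+ 2.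
    by rewrite /s mxE; apply: eq_bigr => j _; rewrite mxE expr2.
  rewrite lt_neqAle eq_sym s_sum sumr_ge0 ?andbT; last by move=> j _; exact: sqr_ge0.
  apply: contra nzA; rewrite psumr_eq0 => [|j _]; last exact: sqr_ge0.
  move=> /allP u0; apply/eqP/rowP => j; rewrite mxE.
  by have := u0 j (mem_index_enum j); rewrite sqrf_eq0 => /eqP.
set e := (Num.sqrt s)^-1 *: u.
have ee : e *m e^T = 1%:M.
  rewrite /e linearZ /= -scalemxAl -scalemxAr scalerA [u *m u^T]mx11_scalar -/s.
  rewrite -invfM -expr2 sqr_sqrtr ?ltW // scale_scalar_mx mulVf //.
  by rewrite gt_eqF.
have eA : (e <= A)%MS by rewrite scalemx_sub // nz_row_sub.
set A' := A - A *m e^T *m e.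
have A'A : (A' <= A)%MS.
  by rewrite addmx_sub ?submx_refl // eqmx_opp (submx_trans (submxMl _ _)).
have A'e : A' *m e^T = 0 by rewrite mulmxBl -!mulmxA ee mulmx1 subrr.
have rA' : \rank A' = r.
  apply/eqP; rewrite eqn_leq; apply/andP; split.
    rewrite -ltnS -rA; apply: rank_ltmx; rewrite ltmxE A'A.
    apply/negP => AA'; have /submxP[D eD] := submx_trans eA AA'.
    have := ee; rewrite eD -mulmxA -eD A'e mulmx0 => /matrixP/(_ 0 0)/eqP.
    by rewrite !mxE eqxx eq_sym oner_eq0.
  rewrite -ltnS -rA -addn1.
  have sA : (A <= A' + e)%MS.
    by rewrite -{1}[A](subrK (A *m e^T *m e)) addmx_sub_adds ?submxMl.
  apply: leq_trans (mxrankS sA) _; apply: leq_trans (mxrank_adds_leqif _ _) _.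
  by rewrite leq_add2l rank_leq_row.
have [Q [QQ A'Q QA']] := IHr _ _ rA'.
have Qe : Q *m e^T = 0.
  by have /submxP[D ->] := QA'; rewrite -mulmxA A'e mulmx0.
have eQ : e *m Q^T = 0 by apply: trmx_inj; rewrite trmx_mul trmxK Qe trmx0.
have eQeQ : col_mx e Q *m (col_mx e Q)^T = 1%:M.
  by rewrite tr_col_mx mul_col_row ee QQ Qe eQ -scalar_mx_block.
have sQ : (Q <= col_mx e Q)%MS by rewrite -addsmxE addsmxSr.
have se : (e <= col_mx e Q)%MS by rewrite -addsmxE addsmxSl.
have seQA : (col_mx e Q <= A)%MS by rewrite col_mx_sub eA (submx_trans QA').
have sAeQ : (A <= col_mx e Q)%MS.
  rewrite -[A in (A <= _)%MS](subrK (A *m e^T *m e)) addmx_sub //.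
    exact: submx_trans sQ.
  exact: submx_trans (submxMl _ _) se.
by exists (col_mx e Q : 'M_(1 + r, n)).
Qed.

(** An orthonormal basis of the orthogonal complement of the rows of Q, which is the
    kernel of Q^T, completes them. *)
Lemma orthogonal_completion p q (Q : 'M[R]_(p, p + q)) : Q *m Q^T = 1%:M ->
  exists Q' : 'M[R]_(q, p + q),
    col_mx Q Q' *m (col_mx Q Q')^T = 1%:M.
Proof.
move=> QQ; have rQ : \rank Q = p.
  apply/eqP; rewrite eqn_leq rank_leq_row -{1}(mxrank1 R p) -QQ.
  exact: mxrankM_maxl.
have rK : \rank (kermx Q^T) = q by rewrite mxrank_ker mxrank_tr rQ addKn.
have [Q' [QQ' _ Q'K]] := orthonormal_basis rK; exists Q'.
have Q'Q : Q' *m Q^T = 0 by apply/sub_kermxP.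
have QQ'0 : Q *m Q'^T = 0 by apply: trmx_inj; rewrite trmx_mul trmxK Q'Q trmx0.
by rewrite tr_col_mx mul_col_row QQ QQ' Q'Q QQ'0 -scalar_mx_block.
Qed.

(** Writing the matrix V of the factors as L Q with Q an orthonormal basis of its
    row space presents xi as the image under Q of a p-vector of R^r, r the rank
    of V.  There is none but 0 if r < p, and if r = p it is a multiple of the
    volume element.  For p = 0 the matrix Q is empty and c is the scalar xi. *)
Lemma simple_decomposition n p (xi : pvector R n p) : simple_pvector xi ->
  xi = 0 \/ exists c (Q : 'M[R]_(p, n)),
    [/\ Q *m Q^T = 1%:M, c ^+ 2 = pnorm xi ^+ 2 &
        embed xi = c *: emap Q (ebasis R [set: 'I_p]%SET)].
Proof.
suff H : simple_pvector xi -> xi = 0 \/ exists c (Q : 'M[R]_(p, n)),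
    Q *m Q^T = 1%:M /\ embed xi = c *: emap Q (ebasis R [set: 'I_p]%SET).
  move=> /H[->|[c [Q [QQ exi]]]]; [by left|right; exists c, Q; split=> //].
  rewrite pnorm_sqr exi innerZr innerZl inner_emap_isometry // inner_ebasisr ebasisE eqxx.
  by rewrite mulr1 expr2.
case=> [p0|[v ->]].
  right; move: p0 xi => -> xi; exists (embed xi set0), 0.
  split; first by rewrite [LHS]flatmx0 [RHS]flatmx0.
  have -> : [set: 'I_0]%SET = set0 by apply/setP => -[].
  rewrite ebasis0 emap1 -ebasis0; apply: exteriorP => K; rewrite exterior_scaleE ebasisE.
  have [->|nK] := eqVneq K set0; first by rewrite mulr1.
  by rewrite mulr0 embed_card // cards_eq0.
pose V := \matrix_i v i.
have [Q [QQ /submxP[L eV] _]] := orthonormal_basis (erefl (\rank V)).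
have := rank_leq_row V; move: (\rank V) Q QQ L eV => r Q QQ L eV.
have -> : wedge_vectors v = pv_map Q (wedge_vectors (fun i => row i L)).
  rewrite pv_map_wedge_vectors; congr wedge_vectors; apply/funext => i.
  by rewrite -row_mul -eV rowK.
rewrite leq_eqVlt => /predU1P[er|lt_rp]; last first.
  left; rewrite (_ : wedge_vectors _ = 0).
    by apply: embed_inj; rewrite embed_pv_map !linear0.
  apply/ffunP => I; have := max_card (mem (val I)).
  by rewrite (eqP (valP I)) card_ord leqNgt lt_rp.
right; subst r; rewrite embed_pv_map.
set x := wedge_vectors _; exists (embed x [set: 'I_p]%SET), Q; split=> //.
by rewrite {1}embed_top linearZ.
Qed.

End EmbeddingMap.

(** * Comass and Euclidean norm *)

Section Comass.
Variable (R : realType).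

Lemma inner_ge0 n (x : exterior R n) : 0 <= inner x x.
Proof. by apply: sumr_ge0 => K _; rewrite -expr2 sqr_ge0. Qed.

Lemma inner_eq0 n (x : exterior R n) : inner x x = 0 -> x = 0.
Proof.
move=> /eqP; rewrite psumr_eq0 => [/allP x0|K _]; last by rewrite -expr2 sqr_ge0.
apply: exteriorP => K; have := x0 K (mem_index_enum K).
by rewrite /= -expr2 sqrf_eq0 => /eqP ->; rewrite ffunE.
Qed.

Lemma inner_cauchy_schwarz n (x y : exterior R n) :
  inner x y ^+ 2 <= inner x x * inner y y.
Proof.
set s := inner x x; set c := inner x y; have [s0|s_neq0] := eqVneq s 0.
  have x0 := inner_eq0 s0; rewrite s0 /c x0 innerC linear0 mul0r expr2 mulr0.
  by [].
have s_gt0 : 0 < s by rewrite lt_neqAle eq_sym s_neq0 inner_ge0.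
(* This vector is s times the component of y orthogonal to x. *)
have := inner_ge0 (s *: y + (- c) *: x).
rewrite linearD /= !innerZr ![inner (_ + _) _]innerC !linearD /= !innerZr.
rewrite (innerC y x) -/s -/c => h.
rewrite -(ler_pM2l s_gt0); nra.
Qed.

Lemma dual_norm_pnorm n p (phi : pcovector R n p) :
  dual_norm phi = pnorm (covector_coords phi).
Proof.
by rewrite dual_normE /pnorm; congr Num.sqrt; apply: eq_bigr => I _; rewrite ffunE.
Qed.

Lemma covector_le_dual_norm n p (phi : pcovector R n p) xi :
  phi xi <= dual_norm phi * pnorm xi.
Proof.
rewrite dual_norm_pnorm covector_inner.
set x := covector_coords phi.
apply: le_trans (ler_norm _) _.
rewrite -(@ler_pXn2r _ 2) ?nnegrE ?mulr_ge0 ?sqrtr_ge0 //.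
by rewrite exprMn !pnorm_sqr real_normK ?num_real // inner_cauchy_schwarz.
Qed.

Lemma le_comass n p (phi : pcovector R n p) xi :
  simple_pvector xi -> pnorm xi <= 1 -> phi xi <= comass phi.
Proof.
move=> simple_xi le1; apply: ub_le_sup; last by exists xi.
exists (dual_norm phi) => _ [eta [_ eta1] <-].
apply: le_trans (covector_le_dual_norm _ _) _.
by rewrite ler_piMr // dual_norm_pnorm sqrtr_ge0.
Qed.

Lemma pnorm0 n p : pnorm (0 : pvector R n p) = 0.
Proof. by rewrite /pnorm big1 ?sqrtr0 // => I _; rewrite ffunE expr0n. Qed.

Lemma comass_le n p (phi : pcovector R n p) (M : R) :
  (forall xi, simple_pvector xi -> pnorm xi <= 1 -> phi xi <= M) ->
  comass phi <= M.
Proof.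
move=> h; apply: ge_sup; last by move=> _ [xi [? ?] <-]; exact: h.
exists (phi 0), 0 => //; split; first exact: simple0.
by rewrite pnorm0.
Qed.

Lemma comass_ge0 n p (phi : pcovector R n p) : 0 <= comass phi.
Proof.
by rewrite -[0](linear0 phi) le_comass ?pnorm0 //; exact: simple0.
Qed.

Lemma pnormZ n p c (xi : pvector R n p) : pnorm (c *: xi) = `|c| * pnorm xi.
Proof.
rewrite /pnorm -sqrtr_sqr -sqrtrM ?sqr_ge0 //; congr Num.sqrt.
by rewrite mulr_sumr; apply: eq_bigr => I _; rewrite ffunE -exprMn.
Qed.

Lemma le_comassZ n p (phi : pcovector R n p) c xi :
  simple_pvector xi -> pnorm xi <= 1 -> c ^+ 2 <= 1 -> c * phi xi <= comass phi.
Proof.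
move=> simple_xi le1 c1; have -> : c * phi xi = phi (c *: xi) by rewrite linearZ.
apply: le_comass; first exact: simpleZ.
rewrite pnormZ; apply: mulr_ile1; rewrite ?normr_ge0 ?sqrtr_ge0 //.
by rewrite -(@expr_le1 _ 2) ?normr_ge0 // real_normK ?num_real.
Qed.

(** The coordinates of phi are its values on the simple unit vectors e_I.  Any bound
    of this kind makes the supremum that defines comass_const a real one. *)
Lemma dual_norm_le_card n p (phi : pcovector R n p) :
  dual_norm phi <= Num.sqrt #|{: multiindex n p}|%:R * comass phi.
Proof.
rewrite dual_normE -[comass phi]ger0_norm ?comass_ge0 // -sqrtr_sqr -sqrtrM ?ler0n //.
apply: ler_wsqrtr; rewrite mulr_natl -sumr_const; apply: ler_sum => I _.
have basis1 : pnorm (basis_pvector R I) <= 1.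
  by rewrite -(@expr_le1 _ 2) ?sqrtr_ge0 // pnorm_sqr embed_basis inner_ebasisr ebasisE eqxx.
have h1 := le_comass phi (simple_basis R I) basis1.
have h2 := @le_comassZ _ _ phi (-1) _ (simple_basis R I) basis1.
rewrite sqrrN expr1n lexx in h2; have {}h2 := h2 isT.
have := comass_ge0 phi; nra.
Qed.

Lemma dual_norm_le_comass n p (phi : pcovector R n p) :
  dual_norm phi <= comass_const R n p * comass phi.
Proof.
have [c0|c_neq0] := eqVneq (comass phi) 0.
  by have := dual_norm_le_card phi; rewrite c0 !mulr0.
have pos (psi : pcovector R n p) : comass psi != 0 -> 0 < comass psi.
  by move=> ?; rewrite lt_neqAle eq_sym comass_ge0 andbT.
rewrite -ler_pdivrMr ?pos //; apply: ub_le_sup; last first.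
  exists phi => //= phi0; case/eqP: c_neq0; apply/eqP; rewrite eq_le comass_ge0 andbT.
  by apply: comass_le => xi _ _; rewrite phi0 lfunE.
exists (Num.sqrt #|{: multiindex n p}|%:R) => _ [psi _ <-].
have [->|/pos c_gt0] := eqVneq (comass psi) 0.
  by rewrite invr0 mulr0 sqrtr_ge0.
by rewrite ler_pdivrMr // dual_norm_le_card.
Qed.

(** * Pullbacks and the Hodge dual *)

(** On coordinates, the pullback by A is the map induced by the adjoint of A; see
    pullbackE for its usual description. *)
Definition pullback m n p (A : 'M[R]_(m, n)) (phi : pcovector R n p) :
    pcovector R m p := covector_of_coords (pv_map A^T (covector_coords phi)).

Lemma pullbackE m n p (A : 'M[R]_(m, n)) (phi : pcovector R n p) xi :
  pullback A phi xi = phi (pv_map A xi).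
Proof.
rewrite !covector_inner covector_of_coordsK !embed_pv_map.
by rewrite innerC -inner_emap innerC.
Qed.

Lemma comass_pullback m n p (Q : 'M[R]_(m, n)) (phi : pcovector R n p) :
  Q *m Q^T = 1%:M -> comass (pullback Q phi) <= comass phi.
Proof.
move=> QQ; apply: comass_le => xi simple_xi le1; rewrite pullbackE.
by apply: le_comass; [exact: simple_pv_map|rewrite pnorm_pv_map].
Qed.

(** The Hodge star up to a sign that depends only on p and q: the pairing of
    xi /\ psi with the volume element, by hodgeE. *)
Definition hodge p q (psi : pcovector R (p + q) q) : pcovector R (p + q) p :=
  covector_of_coords
    [ffun I => (ebasis R (val I) * embed (covector_coords psi))
                 [set: 'I_(p + q)]%SET].

Lemma hodgeE p q (psi : pcovector R (p + q) q) xi :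
  hodge psi xi = (embed xi * embed (covector_coords psi)) [set: 'I_(p + q)]%SET.
Proof.
rewrite covector_of_coordsE {2}/embed mulr_suml exterior_sumE.
apply: eq_bigr => I _; rewrite ffunE -scalerAl exterior_scaleE.
exact: mulrC.
Qed.

(** With xi = c T(e_P), P the first p indices, and T orthogonal, multiplicativity
    moves T off the product: (xi /\ psi)_top = c det(T) (e_P /\ T^T psi)_top, and
    only the coordinate of T^T psi on the complement of P enters.  It is the value
    of psi at zeta = T(e_(~P)), simple and of norm 1. *)
Lemma comass_hodge p q (psi : pcovector R (p + q) q) :
  comass (hodge psi) <= comass psi.
Proof.
apply: comass_le => xi simple_xi le1; rewrite hodgeE.
have [->|[c [Q [QQ c2 ->]]]] := simple_decomposition simple_xi.
  by rewrite linear0 mul0r ffunE comass_ge0.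
have [Q' TT] := orthogonal_completion QQ; set T := col_mx Q Q' in TT.
have TT' := mulmx1C TT.
set b := embed (covector_coords psi); set top := ebasis R [set: 'I_(p + q)]%SET.
have c1 : c ^+ 2 <= 1 by rewrite c2 expr_le1 ?sqrtr_ge0.
pose P := [set lshift q i | i : 'I_p]%SET.
have cP : #|P| == p by rewrite card_imset ?card_ord //; exact: lshift_inj.
have eP : emap Q (ebasis R [set: 'I_p]%SET) = emap T (ebasis R P).
  have -> : ebasis R P = \prod_(i < p) vec (delta_mx 0 (lshift q i)).
    rewrite -embed_wedge_vectors -[P]/(val (Sub P cP : multiindex (p + q) p)) -embed_basis.
    by congr embed; apply/esym/wedge_vectors_basis.
  rewrite emap_ebasis enum_setT rmorph_prod [index_enum _]unlock.
  by apply: eq_bigr => i _; rewrite /= emap_vec -rowE rowKu.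
have cPC : #|~: P| == q by rewrite cardsCs setCK card_ord (eqP cP) addKn.
pose zeta := pv_map T (basis_pvector R (Sub (~: P) cPC : multiindex (p + q) q)).
have simple_zeta : simple_pvector zeta by apply/simple_pv_map/simple_basis.
have zeta1 : pnorm zeta <= 1.
  rewrite -(@expr_le1 _ 2) ?sqrtr_ge0 // pnorm_pv_map // pnorm_sqr embed_basis.
  by rewrite inner_ebasisr ebasisE eqxx.
(* The coefficient d below is det T, and d^2 = 1 because T^T is an isometry. *)
have topE : emap T^T top = (emap T^T top) [set: 'I_(p + q)]%SET *: top.
  have cT : #|[set: 'I_(p + q)]%SET| == (p + q)%N by rewrite cardsT card_ord.
  have -> : top = embed (basis_pvector R
      (Sub [set: 'I_(p + q)]%SET cT : multiindex (p + q) (p + q))).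
    by rewrite embed_basis.
  by rewrite -embed_pv_map {1}embed_top embed_basis.
set d := emap T^T top _ in topE.
have d2 : d ^+ 2 = 1.
  have : inner (emap T^T top) (emap T^T top) = 1.
    by rewrite inner_emap_isometry ?trmxK // inner_ebasisr ebasisE eqxx.
  by rewrite topE innerZl innerZr inner_ebasisr ebasisE eqxx mulr1 expr2.
have bE : b = emap T (emap T^T b) by rewrite emap_comp TT' emap_id.
rewrite -scalerAl exterior_scaleE eP bE -rmorphM -inner_ebasisr inner_emap topE innerZr.
rewrite inner_ebasisr emulE (bigD1 P) ?subsetT //= big1 ?addr0 => [|I /andP[_ nI]]; last first.
  by rewrite ebasisE (negbTE nI) mul0r mulr0.
rewrite ebasisE eqxx mul1r setTD -inner_ebasisr inner_emap trmxK.
have -> : inner b (emap T (ebasis R (~: P))) = psi zeta.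
  by rewrite covector_inner embed_pv_map embed_basis.
rewrite 2!mulrA; apply: le_comassZ => //.
by rewrite !exprMn d2 shuffle_sign_sqr !mulr1.
Qed.

(** The case n = p + q, for the value of the wedge product on the volume element;
    the norm of psi is compared with a comass only after dualizing to degree p. *)
Lemma hodge_pairing_le p q (phi : pcovector R (p + q) p) (psi : pcovector R (p + q) q) :
  `|hodge psi (covector_coords phi)| <=
     comass_const R (p + q) p ^+ 2 * comass phi * comass psi.
Proof.
have dual_ge0 n' p' (f : pcovector R n' p') : 0 <= dual_norm f.
  by rewrite dual_norm_pnorm sqrtr_ge0.
have h : `|hodge psi (covector_coords phi)| <= dual_norm (hodge psi) * dual_norm phi.
  rewrite (dual_norm_pnorm phi) ler_norml covector_le_dual_norm andbT lerNl.
  set x := covector_coords phi; have -> : - hodge psi x = hodge psi (- x).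
    by rewrite linearN.
  apply: le_trans (covector_le_dual_norm _ _) _.
  by rewrite -scaleN1r pnormZ normrN1 mul1r.
apply: le_trans h _.
have le_phi := dual_norm_le_comass phi; have le_hodge := dual_norm_le_comass (hodge psi).
apply: le_trans (ler_pM _ _ le_hodge le_phi) _ => //.
rewrite [X in X <= _](_ : _ =
  comass_const R (p + q) p ^+ 2 * comass phi * comass (hodge psi)); last by ring.
by rewrite ler_wpM2l ?comass_hodge // mulr_ge0 ?sqr_ge0 ?comass_ge0.
Qed.

End Comass.

(** * Comass of a wedge product *)

Theorem corollary4p2 (R : realType) (n p q : nat)
    (phi : pcovector R n p) (psi : pcovector R n q) :
  comass (cowedge phi psi) <=
    comass_const R (p + q) p ^+ 2 * comass phi * comass psi.
Proof.
have const_ge0 : 0 <= comass_const R (p + q) p ^+ 2 by exact: sqr_ge0.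
apply: comass_le => xi simple_xi le1.
have [->|[c [Q [QQ c2 exi]]]] := simple_decomposition simple_xi.
  by rewrite linear0; do 2?[apply: mulr_ge0 => //]; exact: comass_ge0.
rewrite covector_inner covector_of_coordsK embed_wedge exi innerZr.
rewrite innerC inner_emap innerC inner_ebasisr rmorphM /= -!embed_pv_map.
set a := pv_map _ _; set b := pv_map _ _.
have -> : (embed a * embed b) [set: 'I_(p + q)]%SET =
    hodge (pullback Q psi) (covector_coords (pullback Q phi)).
  by rewrite hodgeE /pullback !covector_of_coordsK.
apply: le_trans (ler_norm _) _; rewrite normrM.
apply: le_trans (_ : `|hodge (pullback Q psi) (covector_coords (pullback Q phi))| <= _).
  rewrite ler_piMl // -(@expr_le1 _ 2) // real_normK ?num_real //.
  by rewrite c2 expr_le1 ?sqrtr_ge0.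
apply: le_trans (hodge_pairing_le _ _) _.
rewrite -2!(mulrA (_ ^+ 2)) ler_wpM2l //.
by apply: ler_pM; rewrite ?comass_ge0 ?comass_pullback.
Qed.
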